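(* Let $H\in(0,1)$. The uniform maximum of functions $x\in\mathfrak X^H$ is attained by $x^H$ and equals $$\max_{x\in\mathfrak X^H}\max_{t\in[0,1]}x(t)=\max_{t\in[0,1]}x^H(t)=\frac{1}{3(1-2^{-H})}.$$ The maximal uniform oscillation of functions $x\in\mathfrak X^H$ is given by $$\max_{x\in\mathfrak X^H}\max_{s,t\in[0,1]}|x(t)-x(s)|=\frac{2^H+3}{6(2^H-1)}.$$ It is attained for the points $s=\frac13$ and $t=\frac56$ and for the function $$\widetilde x^H=e_{0,0}+\sum_{m=1}^\infty 2^{m(\frac12-H)}\left(\sum_{k=0}^{2^{m-1}-1}e_{m,k}-\sum_{k=2^{m-1}}^{2^m-1}e_{m,k}\right)\in\mathfrak X^H.$$
   Context: Faber--Schauder functions: for $t\in\mathbb R$, $e_{0,0}(t):=(\min\{t,1-t\})^+$ and $e_{m,k}(t):=2^{-m/2}e_{0,0}(2^mt-k)$ for $m\ge 1$, $k\in\mathbb Z$. For $H\in(0,1)$, the class of signed Takagi--Landsberg functions is $$\mathfrak X^H=\Big\{x\in C[0,1]\ \Big|\ x=\sum_{m=0}^\infty 2^{m(\frac12-H)}\sum_{k=0}^{2^m-1}\theta_{m,k}e_{m,k}\ \text{ for coefficients }\theta_{m,k}\in\{-1,+1\}\Big\},$$ where the series converges uniformly on $[0,1]$ for every choice of the $\theta_{m,k}$. The Takagi--Landsberg function $x^H\in\mathfrak X^H$ is the one with all $\theta_{m,k}=+1$, i.e. $x^H(t)=\sum_{m=0}^\infty 2^{m(1/2-H)}\sum_{k=0}^{2^m-1}e_{m,k}(t)$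 for $t\in[0,1]$. *)

(* Defs.v *)
From HB Require Import structures.
From mathcomp Require Import all_boot all_order all_algebra.
From mathcomp Require Import all_classical all_reals all_analysis.
Set Implicit Arguments.
Unset Strict Implicit.
Unset Printing Implicit Defensive.
Import Order.TTheory GRing.Theory Num.Theory.
Import numFieldNormedType.Exports.
Local Open Scope classical_set_scope.
Local Open Scope ring_scope.

Section FaberSchauder.
Context {R : realType}.
Implicit Types (t H : R) (x : R -> R).

Definition unitI : set R := `[0, 1]%classic.

Definition e00 t : R := Num.max (Num.min t (1 - t)) 0.

(* At m = 0 the prefactor is 1 and only k = 0 is used below, where this is
   e00 itself. *)
Definition fs_e (m : nat) (k : int) t : R :=
  2 `^ (- m%:R / 2) * e00 (2 ^+ m * t - k%:~R).

Definition TL_weight H (m : nat) : R := 2 `^ (m%:R * (1 / 2 - H)).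

Definition TL_partial H (theta : nat -> nat -> R) (n : nat) t : R :=
  \sum_(0 <= m < n) TL_weight H m *
    \sum_(0 <= k < (2 ^ m)%N) theta m k * fs_e m k%:Z t.

(* Elements of C[0,1] are represented by functions on R of which only the
   restriction to [0,1] matters. *)
Definition TL_class H : set (R -> R) :=
  [set x | {within unitI, continuous x} /\
    exists theta : nat -> nat -> R,
      (forall m k, theta m k = -1 \/ theta m k = 1) /\
      {uniform unitI, TL_partial H theta @ \oo --> x}].

Definition TL_fun H t : R :=
  limn (fun n => \sum_(0 <= m < n) TL_weight H m *
    \sum_(0 <= k < (2 ^ m)%N) fs_e m k%:Z t).

Definition TL_fun_tilde H t : R :=
  fs_e 0%N 0 t +
  limn (fun n => \sum_(1 <= m < n) TL_weight H m *
    (\sum_(0 <= k < (2 ^ m.-1)%N) fs_e m k%:Z t -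
     \sum_((2 ^ m.-1)%N <= k < (2 ^ m)%N) fs_e m k%:Z t)).

(* v = max_{a in A} f a, the maximum being attained *)
Definition is_max (T : Type) (A : set T) (f : T -> R) (v : R) : Prop :=
  (exists2 a, A a & f a = v) /\ (forall a, A a -> f a <= v).

(* v = max_{a in A} max_{b in B} f a b: every inner maximum M a exists, and
   the outer maximum of M is v *)
Definition is_max_max (S T : Type) (A : set S) (B : set T)
    (f : S -> T -> R) (v : R) : Prop :=
  exists M : S -> R,
    (forall a, A a -> is_max B (f a) (M a)) /\ is_max A M v.

End FaberSchauder.

(* Main.v *)
Require Import Defs.
From HB Require Import structures.
From mathcomp Require Import all_boot all_order all_algebra.
From mathcomp Require Import all_classical all_reals all_analysis.
From mathcomp Require Import ring lra.
Import Order.TTheory GRing.Theory Num.Theory.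
Import numFieldNormedType.Exports.
Local Open Scope classical_set_scope.
Local Open Scope ring_scope.

(* With r = 2^-H and d_m(t) the distance of 2^m t to the integers, every x in
   the class has |x(t)| <= sum_m r^m d_m(t), with equality for x^H, and
   d_(m+1) = min(2 d_m, 1 - 2 d_m).  Maximising sum_m r^m d_m subject to
   2 d_m + d_(m+1) <= 1 is a linear program; as r >= 1/2 its dual is feasible
   and shows that d_m = 1/3 for all m, i.e. t = 1/3, is optimal.  For the
   oscillation only the m = 0 term is sensitive to the signs: up to symmetry one
   endpoint maximises d_0 + sum_(m >= 1) r^m d_m as before, and the other one
   -d_0 + sum_(m >= 1) r^m d_m, where -d_0 <= -d_1 / 2 reduces the problem to
   the same linear program started at m = 1. *)

(** * The tent function and the distance to the integers *)

Lemma e00_eq0 {R : realType} (x : R) : x <= 0 \/ 1 <= x -> e00 x = 0.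
Proof.
move=> hx; apply/max_idPr; rewrite ge_min; apply/orP.
by case: hx => ?; [left | right; lra].
Qed.

Lemma e00_itv {R : realType} (x : R) : 0 <= x <= 1 ->
  e00 x = Num.min x (1 - x).
Proof. by move=> hx; apply/max_idPl; rewrite le_min; apply/andP; split; lra. Qed.

Lemma continuous_e00 {R : realType} : continuous (@e00 R).
Proof.
move=> x; have cid : {for x, continuous (@id R)} by exact: cvg_id.
apply: (@continuous_max R R (id \min (fun t => 1 - t)) (cst 0) x _ _).
  apply: (@continuous_min R R id (fun t => 1 - t) x cid _).
  by apply: continuousB; [exact: cvg_cst | exact: cid].
exact: cvg_cst.
Qed.

(** For [y >= 0] this is the distance from [y] to the nearest integer. *)
Definition dist_nat {R : realType} (y : R) : R := e00 (y - (Num.truncn y)%:R).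

Lemma dist_natE {R : realType} (k : nat) (y : R) :
  k%:R <= y < k.+1%:R -> dist_nat y = e00 (y - k%:R).
Proof. by move=> /truncn_def <-. Qed.

Lemma dist_nat_ge0 {R : realType} (y : R) : 0 <= dist_nat y.
Proof. by rewrite /dist_nat /e00 le_max lexx orbT. Qed.

Lemma dist_nat_le {R : realType} (y : R) : dist_nat y <= 1 / 2.
Proof.
rewrite /dist_nat /e00 ge_max ge_min; apply/andP; split; last by lra.
by apply/orP; case: (lerP (y - (Num.truncn y)%:R) (1 / 2)) => ?; [left|right; lra].
Qed.

Lemma dist_nat_double {R : realType} (y : R) : 0 <= y ->
  dist_nat (2 * y) = Num.min (2 * dist_nat y) (1 - 2 * dist_nat y).
Proof.
move=> y0; have := truncn_itv y0; rewrite /(dist_nat y).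
move: (Num.truncn y) => k; rewrite -natr1 => yk.
rewrite (e00_itv (y - k%:R)); last by lra.
(* The integer part of [2 * y] is [2 * k] or [(2 * k).+1], according to the half of the unit
   interval containing the fractional part; in the second half the two arguments of the minimum are
   exchanged. *)
have [f2|f2] := ltP (y - k%:R) (1 / 2).
- rewrite (dist_natE (2 * k)); last by rewrite -natr1 natrM; lra.
  rewrite e00_itv natrM; last by lra.
  rewrite (min_idPl (_ : y - k%:R <= 1 - (y - k%:R))); last by lra.
  by congr Num.min; lra.
- rewrite (dist_natE (2 * k).+1); last by rewrite -!natr1 natrM; lra.
  rewrite e00_itv -!natr1 natrM; last by lra.
  rewrite (min_idPr (_ : 1 - (y - k%:R) <= y - k%:R)); last by lra.
  by rewrite minC; congr Num.min; lra.
Qed.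

(* The e00 (y - k) have pairwise disjoint supports; at the right end y = n both
   sides vanish, although theta (truncn y) is then out of range. *)
Lemma sum_e00 {R : realType} (theta : nat -> R) (n : nat) (y : R) :
  0 <= y <= n%:R ->
  \sum_(0 <= k < n) theta k * e00 (y - k%:R) =
  theta (Num.truncn y) * dist_nat y.
Proof.
move=> /andP[y0 yn]; have := truncn_itv y0; rewrite /dist_nat.
move: (Num.truncn y) => j /andP[jy yj].
have off k : k != j -> e00 (y - k%:R) = 0.
  rewrite neq_ltn => /orP[kj|jk]; apply: e00_eq0.
  - right; have : k.+1%:R <= j%:R :> R by rewrite ler_nat.
    by rewrite -natr1; lra.
  - left; have : j.+1%:R <= k%:R :> R by rewrite ler_nat.
    by lra.
have [jn|nj] := ltnP j n.
- rewrite (bigD1_seq j) ?mem_index_iota ?iota_uniq //= big1 ?addr0 //.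
  by move=> k /off ->; rewrite mulr0.
- have nj' : n%:R <= j%:R :> R by rewrite ler_nat.
  rewrite (e00_eq0 (y - j%:R)) ?mulr0; last by left; lra.
  rewrite big_nat_cond big1 // => k; rewrite andbT => /andP[_ kn].
  by rewrite off ?mulr0 // neq_ltn (leq_trans kn nj).
Qed.

(** * Levels of the expansion in terms of [dist_nat] *)

Lemma expDn_unitI {R : realType} (m : nat) (t : R) : unitI t ->
  0 <= 2 ^+ m * t <= (2 ^ m)%:R.
Proof.
rewrite /unitI /= in_itv /= => /andP[t0 t1].
have e : 0 <= 2 ^+ m :> R by rewrite exprn_ge0.
by rewrite natrX mulr_ge0 //= ler_piMr.
Qed.

(** The factors [2^(m/2)] and [2^(-m/2)] cancel, which leaves [2^(-mH)]. *)
Lemma TL_weight_fs_e {R : realType} (H t : R) (m k : nat) :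
  TL_weight H m * fs_e m k t = (2 `^ (- H)) ^+ m * e00 (2 ^+ m * t - k%:R).
Proof.
rewrite /TL_weight /fs_e mulrA -powRD; last by rewrite pnatr_eq0 implybT.
rewrite -(powR_mulrn m (powR_ge0 2 (- H))) -powRrM pmulrn; congr (2 `^ _ * _).
by lra.
Qed.

Lemma TL_block {R : realType} (H t : R) (theta : nat -> R) (m : nat) :
  unitI t ->
  TL_weight H m * \sum_(0 <= k < (2 ^ m)%N) theta k * fs_e m k%:Z t =
  (2 `^ (- H)) ^+ m *
    (theta (Num.truncn (2 ^+ m * t)) * dist_nat (2 ^+ m * t)).
Proof.
move=> t01; rewrite -(sum_e00 theta _ _ (expDn_unitI m t t01)) !mulr_sumr.
by apply: eq_bigr => k _; rewrite mulrCA TL_weight_fs_e mulrCA.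
Qed.

Lemma TL_partialE {R : realType} (H t : R) (theta : nat -> nat -> R) (n : nat) :
  unitI t ->
  TL_partial H theta n t = \sum_(0 <= m < n) (2 `^ (- H)) ^+ m *
    (theta m (Num.truncn (2 ^+ m * t)) * dist_nat (2 ^+ m * t)).
Proof. by move=> t01; apply: eq_bigr => m _; exact: TL_block. Qed.

(** The lower bound, from [H < 1], is the dual feasibility of the linear program; the upper one,
    from [0 < H], gives geometric convergence. *)
Lemma ratio_itv {R : realType} (H : R) : 0 < H -> H < 1 ->
  1 / 2 < 2 `^ (- H) < 1.
Proof.
move=> H0 H1; rewrite powRN.
have h1 : 1 `^ H < 2 `^ H by apply: gt0_ltr_powR; rewrite ?nnegrE; lra.
rewrite powR1 in h1.
have h2 : 2 `^ H < 2.
  rewrite -[ltRHS](powRr1 (ler0n _ 2)).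
  by rewrite /powR pnatr_eq0 /= ltr_expR ltr_pM2r // ln_gt0; lra.
rewrite invf_lt1 ?h1 ?andbT; last by lra.
by rewrite div1r ltf_pV2 // posrE; lra.
Qed.

(* LP duality: the dual variables are z_0 = c, z_(n+1) = r^(n+1) - z_n / 2,
   which stay in [0, r^n] because r >= 1/2. *)
Lemma weighted_sum_le {R : realType} (r c : R) (v : nat -> R) (n : nat) :
  1 / 2 <= r -> 0 <= c <= 1 ->
  (forall m, 2 * v m + v m.+1 <= 0) -> (forall m, v m <= 1 / 6) ->
  c * v 0%N + \sum_(1 <= m < n.+1) r ^+ m * v m <= r ^+ n / 6.
Proof.
move=> r2 c01 v2 v6.
suff [z [z0 zr zv]] : exists z, [/\ 0 <= z, z <= r ^+ n &
    c * v 0%N + \sum_(1 <= m < n.+1) r ^+ m * v m <= z * v n].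
  by apply: (le_trans zv); have := v6 n; nra.
elim: n => [|n [z [z0 zr IH]]].
  by exists c; rewrite big_geq // addr0 expr0; split => //; lra.
exists (r ^+ n.+1 - z / 2); rewrite big_nat_recr //= exprS.
(* Multiplied by [z / 2], the constraint [vn] trades [z * v n] for [- z / 2 * v n.+1]; the new
   multiplier is nonnegative since [z <= r ^+ n <= 2 * r ^+ n.+1]. *)
have vn := v2 n; have rn : 0 <= r ^+ n by exact: le_trans zr.
by split; nra.
Qed.

(** * Series with a geometric majorant *)

Lemma norm_sum_geometric_tail {R : realType} (r : R) (u : nat -> R) (n N : nat) :
  0 < r < 1 -> (n <= N)%N -> (forall m, `|u m| <= r ^+ m) ->
  `|\sum_(0 <= m < N) u m - \sum_(0 <= m < n) u m| <= r ^+ n / (1 - r).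
Proof.
move=> /andP[r0 r1] nN ur; rewrite (big_cat_nat _ nN) //= addrAC subrr add0r.
rewrite (le_trans (ler_norm_sum _ _ _)) //.
rewrite (le_trans (ler_sum _ (fun m _ => ur m))) //.
rewrite -{1}[n]add0n big_addn; under eq_bigr do rewrite exprD mulrC.
rewrite -mulr_sumr ler_pM2l ?exprn_gt0 // -[leRHS]mul1r.
rewrite [leLHS](_ : _ = series (geometric 1 r) (N - n)%N); last first.
  by apply: eq_bigr => i _; rewrite /= mul1r.
by apply: geometric_le_lim => //; rewrite ger0_norm // ltW.
Qed.

Lemma is_cvg_geometric_bound {R : realType} (r : R) (u : nat -> R) :
  0 < r < 1 -> (forall m, `|u m| <= r ^+ m) ->
  cvgn (fun n => \sum_(0 <= m < n) u m).
Proof.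
move=> /andP[r0 r1] ur; apply: normed_cvg.
apply: (series_le_cvg (v_ := geometric 1 r)) => [n|n|n|].
- exact: normr_ge0.
- by rewrite /= mul1r exprn_ge0 // ltW.
- by rewrite /= mul1r.
- by apply: is_cvg_geometric_series; rewrite ger0_norm // ltW.
Qed.

(** Weierstrass M-test: the tail bound [r ^+ n / (1 - r)] does not depend on the point. *)
Lemma uniform_cvg_geometric_bound {R : realType} (A : set R) (f : nat -> R -> R)
    (x : R -> R) (r : R) :
  0 < r < 1 -> (forall m t, A t -> `|f m t| <= r ^+ m) ->
  (forall t, A t -> x t = limn (fun n => \sum_(0 <= m < n) f m t)) ->
  {uniform A, (fun n t => \sum_(0 <= m < n) f m t) @ \oo --> x}.
Proof.
move=> r01 fr xE.
have bd n t : A t -> `|\sum_(0 <= m < n) f m t - x t| <= r ^+ n / (1 - r).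
  move=> At; have cv := is_cvg_geometric_bound r (f ^~ t) r01 (fr ^~ t ^~ At).
  rewrite distrC xE //; apply: (cvgr_to_le (cvg_norm (cvgB cv (cvg_cst _)))).
  near=> N; apply: norm_sum_geometric_tail => // [|m]; last exact: fr.
  by near: N; exact: nbhs_infty_ge.
move=> P /uniform_nbhs[E []]; rewrite -entourage_ballE => -[e /= e0 eE] EP.
case/andP: r01 => r0 r1; rewrite /nbhs /=; near=> n.
apply: EP => t At; apply: eE => /=; rewrite /ball /= distrC.
apply: le_lt_trans (bd n t At) _.
rewrite -[ltLHS]ger0_norm; last first.
  by rewrite divr_ge0 ?exprn_ge0 ?subr_ge0 // ltW.
rewrite mulrC; near: n; apply: cvgr0_norm_lt => //.
by apply: (cvg_geometric (1 - r)^-1); rewrite ger0_norm // ltW.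
Unshelve. all: by end_near. Qed.

(** * Membership in the class *)

Definition is_signs {R : realType} (theta : nat -> nat -> R) : Prop :=
  forall m k, theta m k = -1 \/ theta m k = 1.

Lemma norm_signs {R : realType} (theta : nat -> nat -> R) (m k : nat) :
  is_signs theta -> `|theta m k| = 1.
Proof. by case/(_ m k) => ->; rewrite ?normrN normr1. Qed.

Lemma TL_partial_continuous {R : realType} (H : R) (theta : nat -> nat -> R)
  (n : nat) : continuous (TL_partial H theta n).
Proof.
apply: continuous_big => [|m _]; first exact: add_continuous.
move=> t; apply: cvgM; first exact: cvg_cst.
move: t; apply: continuous_big => [|k _ t]; first exact: add_continuous.
apply: cvgM; first exact: cvg_cst.
apply: cvgM; first exact: cvg_cst.
apply: (@continuous_comp R R R (fun t => 2 ^+ m * t - k%:~R) e00).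
  by apply: cvgB; [apply: cvgM; [exact: cvg_cst | exact: cvg_id] | exact: cvg_cst].
exact: continuous_e00.
Qed.

Lemma norm_TL_block_le {R : realType} (H t : R) (theta : nat -> nat -> R)
    (m : nat) : is_signs theta -> unitI t ->
  `|TL_weight H m * \sum_(0 <= k < (2 ^ m)%N) theta m k * fs_e m k%:Z t| <=
  (2 `^ (- H)) ^+ m.
Proof.
move=> sgn t01; rewrite TL_block // normrM ger0_norm ?exprn_ge0 ?powR_ge0 //.
rewrite ler_piMr ?exprn_ge0 ?powR_ge0 // normrM norm_signs // mul1r.
by rewrite ger0_norm ?dist_nat_ge0 // (le_trans (dist_nat_le _)) //; lra.
Qed.

Lemma is_cvg_TL_partial {R : realType} (H t : R) (theta : nat -> nat -> R) :
  0 < H -> H < 1 -> is_signs theta -> unitI t ->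
  cvgn (TL_partial H theta ^~ t).
Proof.
move=> H0 H1 sgn t01; have /andP[r2 r1] := ratio_itv H H0 H1.
apply: (is_cvg_geometric_bound (2 `^ (- H))); first by apply/andP; split; lra.
by move=> m; exact: norm_TL_block_le.
Qed.

(** The M-test upgrades the pointwise limit to a uniform one, and a uniform limit of continuous
    functions is continuous. *)
Lemma TL_class_lim {R : realType} (H : R) (theta : nat -> nat -> R) (x : R -> R) :
  0 < H -> H < 1 -> is_signs theta ->
  (forall t, unitI t -> x t = limn (TL_partial H theta ^~ t)) -> TL_class H x.
Proof.
move=> H0 H1 sgn xE; have /andP[r2 r1] := ratio_itv H H0 H1.
suff ux : {uniform unitI, TL_partial H theta @ \oo --> x}.
  split; last by exists theta.
  apply: (uniform_limit_continuous_subspace _ _ ux).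
  near_simpl; apply: nearW => n.
  apply: continuous_subspaceT; exact: (TL_partial_continuous H theta n).
apply: (uniform_cvg_geometric_bound unitI _ x (2 `^ (- H))) => //.
- by apply/andP; split; lra.
- by move=> m t t01; exact: norm_TL_block_le.
Qed.

Lemma TL_class_cvg {R : realType} (H : R) (x : R -> R) : TL_class H x ->
  exists2 theta, is_signs theta &
    forall t, unitI t -> TL_partial H theta n t @[n --> \oo] --> x t.
Proof.
move=> [_ [theta [sgn ux]]]; exists theta => // t t01.
have st : [set t] `<=` (@unitI R) by move=> _ ->.
have sx : {uniform [set t], TL_partial H theta @ \oo --> x}.
  exact: uniform_subset_cvg st ux.
by rewrite uniform_set1 in sx.
Qed.

(** * Bounds from the linear program *)

(** Centring at [1 / 3], where the constraint [2 * d m + d m.+1 <= 1] is tight, makes it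
    homogeneous, so [weighted_sum_le] applies with [c = 1]. *)
Lemma sum_le_third {R : realType} (r : R) (d : nat -> R) (n : nat) :
  1 / 2 <= r -> (forall m, 2 * d m + d m.+1 <= 1) -> (forall m, d m <= 1 / 2) ->
  \sum_(0 <= m < n.+1) r ^+ m * d m <=
  1 / 3 * (\sum_(0 <= m < n.+1) r ^+ m) + r ^+ n / 6.
Proof.
move=> r2 d2 dh; have h1 : 0 <= (1 : R) <= 1 by rewrite ler01 lexx.
have hv m : 2 * (d m - 1 / 3) + (d m.+1 - 1 / 3) <= 0 by have := d2 m; lra.
have h6 m : d m - 1 / 3 <= 1 / 6 by have := dh m; lra.
have := weighted_sum_le r 1 (fun m => d m - 1 / 3) n r2 h1 hv h6.
rewrite !(@big_ltn _ _ _ 0) // expr0 !mul1r.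
rewrite (eq_bigr (fun m => r ^+ m * d m - 1 / 3 * r ^+ m)); last first.
  by move=> m _; ring.
by rewrite sumrB -mulr_sumr; lra.
Qed.

(* The first term is traded for the second one through -2 d_0 <= -d_1, which
   leaves the nonnegative coefficient r - 1/2 in front of d_1. *)
Lemma sum_negl_le_third {R : realType} (r : R) (d : nat -> R) (n : nat) :
  1 / 2 <= r -> (forall m, 2 * d m + d m.+1 <= 1) -> (forall m, d m <= 1 / 2) ->
  d 1%N <= 2 * d 0%N ->
  - d 0%N + \sum_(1 <= m < n.+2) r ^+ m * d m <=
  1 / 3 * (\sum_(0 <= m < n.+2) r ^+ m) - 1 / 2 + r ^+ n.+1 / 6.
Proof.
move=> r2 d2 dh d10; have r0 : 0 < r by lra.
(* Starting at level 1 factors out one [r], so [c] is the remaining coefficient of [d 1]. At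
   [d = 1 / 3] the lowered coefficient [- 1 / 2] and the missing term [1] of the geometric sum cost
   [(1 + 1 / 2) / 3 = 1 / 2]. *)
have [c hc rc] : exists2 c, 0 <= c <= 1 & r * c = r - 1 / 2.
  exists ((r - 1 / 2) / r); last by rewrite mulrC divfK ?gt_eqF.
  by apply/andP; split; [apply: divr_ge0 | rewrite ler_pdivrMr //]; lra.
have hv m : 2 * (d m.+1 - 1 / 3) + (d m.+2 - 1 / 3) <= 0.
  by have := d2 m.+1; lra.
have h6 m : d m.+1 - 1 / 3 <= 1 / 6 by have := dh m.+1; lra.
have := weighted_sum_le r c (fun m => d m.+1 - 1 / 3) n r2 hc hv h6.
rewrite -(ler_pM2l r0) mulrDr mulrA rc.
have -> : \sum_(1 <= m < n.+2) r ^+ m * d m =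
    r * d 1%N + \sum_(1 <= m < n.+1) r ^+ m.+1 * d m.+1.
  by rewrite big_add1 /= big_ltn // expr1.
have -> : \sum_(0 <= m < n.+2) r ^+ m =
    1 + r + \sum_(1 <= m < n.+1) r ^+ m.+1.
  by rewrite big_ltn // big_add1 /= big_ltn // addrA.
have -> : r * \sum_(1 <= m < n.+1) r ^+ m * (d m.+1 - 1 / 3) =
    \sum_(1 <= m < n.+1) r ^+ m.+1 * d m.+1 -
    1 / 3 * \sum_(1 <= m < n.+1) r ^+ m.+1.
  by rewrite !mulr_sumr -sumrB; apply: eq_bigr => m _; rewrite exprS; ring.
by rewrite exprS; lra.
Qed.

Lemma unitIP {R : realType} (t : R) : reflect (unitI t) (0 <= t <= 1).
Proof. by rewrite /unitI /= in_itv /=; exact: idP. Qed.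

Lemma dist_nat_expS {R : realType} (t : R) (m : nat) : 0 <= t ->
  dist_nat (2 ^+ m.+1 * t) =
  Num.min (2 * dist_nat (2 ^+ m * t)) (1 - 2 * dist_nat (2 ^+ m * t)).
Proof. by move=> t0; rewrite exprS -mulrA dist_nat_double // mulr_ge0. Qed.

(** At [t = 1] the truncation is 1 instead of 0, but [dist_nat] vanishes there. Hence all points
    share one sign at level 0. *)
Lemma trunc_unitI {R : realType} (theta : nat -> R) (t : R) : unitI t ->
  theta (Num.truncn (2 ^+ 0 * t)) * dist_nat (2 ^+ 0 * t) =
  theta 0%N * dist_nat (2 ^+ 0 * t).
Proof.
move=> /(expDn_unitI 0) t01; rewrite -(sum_e00 theta _ _ t01) big_nat1.
congr (_ * _); rewrite -[RHS]mul1r.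
by rewrite -(sum_e00 (fun=> 1) _ _ t01) big_nat1 mul1r.
Qed.

Section Bounds.
Variables (R : realType) (H : R).
Hypotheses (H_gt0 : 0 < H) (H_lt1 : H < 1).
Local Notation r := (2 `^ (- H)).
Local Notation G := (fun n : nat => \sum_(0 <= m < n) r ^+ m).

Let r_gt0 : 0 < r. Proof. exact: powR_gt0. Qed.
Let r_ge : 1 / 2 <= r.
Proof. by have /andP[/ltW] := ratio_itv H H_gt0 H_lt1. Qed.
Let r_lt1 : r < 1.
Proof. by have /andP[] := ratio_itv H H_gt0 H_lt1. Qed.

Let d_step (t : R) : 0 <= t -> forall m,
  2 * dist_nat (2 ^+ m * t) + dist_nat (2 ^+ m.+1 * t) <= 1.
Proof.
move=> t0 m; rewrite dist_nat_expS // addrC -lerBrDr ge_min; apply/orP; right.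
by rewrite lexx.
Qed.

Lemma cvg_G : G n @[n --> \oo] --> (1 - r)^-1.
Proof.
have -> : G = series (geometric 1 r).
  by apply/funext => n; apply: eq_bigr => m _; rewrite /= mul1r.
by rewrite -[X in _ --> X]mul1r; apply: cvg_geometric_series; rewrite gtr0_norm.
Qed.

Let cvg_r : r ^+ n @[n --> \oo] --> (0 : R).
Proof. by apply: cvg_expr; rewrite gtr0_norm. Qed.

Lemma TL_partial_le (theta : nat -> nat -> R) (t : R) (n : nat) :
  is_signs theta -> unitI t ->
  TL_partial H theta n.+1 t <= 1 / 3 * G n.+1 + r ^+ n / 6.
Proof.
move=> sgn t01; have /unitIP/andP[t0 _] := t01.
apply: le_trans (sum_le_third r _ n r_ge (d_step t t0) (fun m => dist_nat_le _)).
rewrite TL_partialE //; apply: ler_sum => m _; rewrite ler_pM2l ?exprn_gt0 //.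
rewrite (le_trans (ler_norm _)) // normrM norm_signs // mul1r.
by rewrite ger0_norm // dist_nat_ge0.
Qed.

Lemma TL_partial_sub_le (theta : nat -> nat -> R) (s t : R) (n : nat) :
  is_signs theta -> unitI s -> unitI t ->
  TL_partial H theta n.+2 t - TL_partial H theta n.+2 s <=
  2 / 3 * G n.+2 - 1 / 2 + r ^+ n.+1 / 3.
Proof.
move=> sgn s01 t01; pose d0 y : R := dist_nat (2 ^+ 0 * y).
pose q (y : R) := \sum_(1 <= m < n.+2) r ^+ m * dist_nat (2 ^+ m * y).
have up y : unitI y -> d0 y + q y <= 1 / 3 * G n.+2 + r ^+ n.+1 / 6.
  move=> /unitIP/andP[y0 _].
  have := sum_le_third r _ n.+1 r_ge (d_step y y0) (fun m => dist_nat_le _).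
  by rewrite big_ltn // expr0 mul1r.
have lo y : unitI y -> - d0 y + q y <= 1 / 3 * G n.+2 - 1 / 2 + r ^+ n.+1 / 6.
  move=> /unitIP/andP[y0 _].
  apply: (sum_negl_le_third r (fun m => dist_nat (2 ^+ m * y))) => //.
  - exact: (d_step y y0).
  - by move=> m; exact: dist_nat_le.
  - by rewrite (dist_nat_expS y 0) // ge_min lexx.
have Pq y : unitI y -> `|TL_partial H theta n.+2 y - theta 0%N 0%N * d0 y| <= q y.
  move=> y01; rewrite TL_partialE // big_ltn // expr0 mul1r trunc_unitI //.
  rewrite addrAC subrr add0r (le_trans (ler_norm_sum _ _ _)) //.
  apply: ler_sum => m _.
  rewrite !normrM norm_signs // mul1r (ger0_norm (dist_nat_ge0 _)).
  by rewrite gtr0_norm // exprn_gt0.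
(* If [theta 0 0 = 1], then [up] bounds the value at [t] and [lo] minus the value at [s]; if it is
   [-1], the two points exchange roles. *)
move: (up s s01) (up t t01) (lo s s01) (lo t t01) (Pq s s01) (Pq t t01).
by case: (sgn 0%N 0%N) => ->; rewrite !ler_norml => ? ? ? ? /andP[? ?] /andP[? ?]; lra.
Qed.

Lemma TL_class_le (x : R -> R) (t : R) : TL_class H x -> unitI t ->
  x t <= 1 / (3 * (1 - r)).
Proof.
move=> /TL_class_cvg[theta sgn /(_ t) xt] t01.
have : 1 / 3 * G n.+1 + r ^+ n / 6 @[n --> \oo] --> 1 / 3 * (1 - r)^-1 + 0 / 6.
  apply: cvgD; apply: cvgM; [exact: cvg_cst| |exact: cvg_r|exact: cvg_cst].
  by rewrite (cvg_shiftS G); exact: cvg_G.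
rewrite mul0r addr0 => cvb; rewrite invfM mulrA.
apply: (ler_cvg_to (f := fun n => TL_partial H theta n.+1 t) _ cvb).
  by rewrite (cvg_shiftS (fun n => TL_partial H theta n t)); exact: xt.
by apply: nearW => n; exact: TL_partial_le.
Qed.

Lemma TL_class_sub_le (x : R -> R) (s t : R) : TL_class H x ->
  unitI s -> unitI t -> x t - x s <= 2 / 3 * (1 - r)^-1 - 1 / 2.
Proof.
move=> /TL_class_cvg[theta sgn xE] s01 t01.
have : 2 / 3 * G n.+2 - 1 / 2 + r ^+ n.+1 / 3 @[n --> \oo] -->
    2 / 3 * (1 - r)^-1 - 1 / 2 + 0 / 3.
  apply: cvgD; [apply: cvgB; [|exact: cvg_cst] |]; apply: cvgM;
    [exact: cvg_cst| | |exact: cvg_cst].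
  - rewrite (cvg_shiftS (fun n => G n.+1)) (cvg_shiftS G); exact: cvg_G.
  - rewrite (cvg_shiftS (fun n => r ^+ n)); exact: cvg_r.
rewrite mul0r addr0.
pose P n := TL_partial H theta n t - TL_partial H theta n s.
move=> cvb; apply: (ler_cvg_to (f := fun n => P n.+2) _ cvb).
  rewrite (cvg_shiftS (fun n => P n.+1)) (cvg_shiftS P).
  by apply: cvgB; exact: xE.
by apply: nearW => n; exact: TL_partial_sub_le.
Qed.

End Bounds.

(** * Values at the extremal points 1/3 and 5/6 *)

(** [1 / 3] is a fixed point of the recursion [d = min(2 d, 1 - 2 d)]; the orbit of 5/6 reaches it
    at level 1. *)
Lemma dist_nat_third {R : realType} (m : nat) :
  dist_nat (2 ^+ m * (1 / 3)) = 1 / 3 :> R.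
Proof.
elim: m => [|m IH]; last first.
  by rewrite dist_nat_expS ?IH; [rewrite (min_idPr _) | ]; lra.
rewrite expr0 (dist_natE 0) ?e00_itv ?(min_idPl _); lra.
Qed.

Lemma dist_nat_five_sixths {R : realType} (m : nat) :
  dist_nat (2 ^+ m.+1 * (5 / 6)) = 1 / 3 :> R.
Proof.
elim: m => [|m IH]; last first.
  by rewrite dist_nat_expS ?IH; [rewrite (min_idPr _) | ]; lra.
rewrite expr1 (dist_natE 1) ?e00_itv ?(min_idPr _); lra.
Qed.

(** As [0.-1 = 0], the only index [k = 0] of level 0 gets the sign [1], in accordance with the
    leading term of [TL_fun_tilde]. *)
Definition theta_tilde {R : realType} (m k : nat) : R :=
  if (k < 2 ^ m.-1)%N then 1 else -1.

Lemma theta_tilde_signs {R : realType} : is_signs (@theta_tilde R).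
Proof. by move=> m k; rewrite /theta_tilde; case: ifP; [right | left]. Qed.

Lemma theta_tilde_third {R : realType} (m : nat) :
  theta_tilde m (Num.truncn (2 ^+ m * (1 / 3) : R)) = 1 :> R.
Proof.
rewrite /theta_tilde truncn_lt_nat; last by rewrite mulr_ge0 ?exprn_ge0 //; lra.
rewrite natrX ifT //; case: m => [|m] /=; first by rewrite !expr0; lra.
by have : 0 < 2 ^+ m :> R by [rewrite exprn_gt0]; rewrite exprS; lra.
Qed.

Lemma theta_tilde_five_sixths {R : realType} (m : nat) :
  theta_tilde m.+1 (Num.truncn (2 ^+ m.+1 * (5 / 6) : R)) = -1 :> R.
Proof.
rewrite /theta_tilde truncn_lt_nat; last by rewrite mulr_ge0 ?exprn_ge0 //; lra.
rewrite natrX ifF //=; apply/negbTE; rewrite -leNgt exprS.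
by have : 0 < 2 ^+ m :> R by [rewrite exprn_gt0]; lra.
Qed.

Lemma TL_funE {R : realType} (H t : R) :
  TL_fun H t = limn (TL_partial H (fun _ _ => 1) ^~ t).
Proof.
congr (lim (_ @ \oo)); apply/funext => n; apply: eq_bigr => m _.
by congr (_ * _); apply: eq_bigr => k _; rewrite mul1r.
Qed.

Lemma TL_fun_tildeE {R : realType} (H t : R) : 0 < H -> H < 1 -> unitI t ->
  TL_fun_tilde H t = limn (TL_partial H theta_tilde ^~ t).
Proof.
move=> H0 H1 t01.
have cvP : cvgn (TL_partial H theta_tilde ^~ t).
  exact: is_cvg_TL_partial theta_tilde_signs t01.
rewrite /TL_fun_tilde; set Q := (X in limn X).
(* The shift to [n.+1] is needed: at [n = 0] both sums are empty and the term of level 0 is missing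
   on the left. *)
have PQ n : TL_partial H theta_tilde n.+1 t = fs_e 0 0 t + Q n.+1.
  have w0 : TL_weight H 0 = 1 by rewrite /TL_weight mul0r powRr0.
  rewrite /TL_partial big_ltn // big_nat1 w0 !mul1r.
  congr (_ + _).
  rewrite /Q; apply: eq_big_nat => m /andP[m0 _]; congr (_ * _).
  rewrite (big_cat_nat _ (leq_pexp2l _ (leq_pred m))) //=; congr (_ + _).
    by apply: eq_big_nat => k /andP[_ km]; rewrite /theta_tilde km mul1r.
  rewrite -sumrN; apply: eq_big_nat => k /andP[km _].
  by rewrite /theta_tilde ltnNge km mulN1r.
have cvQ : Q n @[n --> \oo] --> limn (TL_partial H theta_tilde ^~ t) - fs_e 0 0 t.
  rewrite -(cvg_shiftS Q).
  rewrite (_ : (fun n => Q n.+1) = (fun n => TL_partial H theta_tilde n.+1 t - fs_e 0 0 t)).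
    apply: cvgB; last exact: cvg_cst.
    by rewrite (cvg_shiftS (fun n => TL_partial H theta_tilde n t)).
  by apply/funext => n; rewrite PQ addrC addKr.
by rewrite (cvg_lim _ cvQ) // addrC subrK.
Qed.

Section Extremisers.
Variables (R : realType) (H : R).
Hypotheses (H_gt0 : 0 < H) (H_lt1 : H < 1).
Local Notation r := (2 `^ (- H)).

Lemma unitI_third : unitI (1 / 3 : R). Proof. by rewrite /unitI /= in_itv /=; lra. Qed.

Lemma unitI_five_sixths : unitI (5 / 6 : R). Proof. by rewrite /unitI /= in_itv /=; lra. Qed.

Lemma TL_partial_third (theta : nat -> nat -> R) :
  (forall m, theta m (Num.truncn (2 ^+ m * (1 / 3) : R)) = 1) ->
  limn (TL_partial H theta ^~ (1 / 3)) = 1 / (3 * (1 - r)).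
Proof.
move=> th1; apply/cvg_lim => //; rewrite invfM mulrA.
rewrite (_ : TL_partial H theta ^~ (1 / 3) =
    fun n => 1 / 3 * \sum_(0 <= m < n) r ^+ m).
  by apply: cvgM; [exact: cvg_cst | exact: cvg_G].
apply/funext => n; rewrite TL_partialE ?mulr_sumr; last exact: unitI_third.
by apply: eq_bigr => m _; rewrite th1 dist_nat_third mul1r mulrC.
Qed.

Lemma TL_fun_third : TL_fun H (1 / 3) = 1 / (3 * (1 - r)).
Proof. by rewrite TL_funE TL_partial_third. Qed.

Lemma TL_fun_tilde_third : TL_fun_tilde H (1 / 3) = 1 / (3 * (1 - r)).
Proof.
rewrite TL_fun_tildeE //; last exact: unitI_third.
by apply: TL_partial_third => m; exact: theta_tilde_third.
Qed.

(** Level 0 contributes [1 / 6] and each level [m >= 1] contributes [- r ^+ m / 3]; completing the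
    geometric series by its term [1 / 3] turns [1 / 6] into [1 / 2]. *)
Lemma TL_fun_tilde_five_sixths :
  TL_fun_tilde H (5 / 6) = 1 / 2 - 1 / (3 * (1 - r)).
Proof.
rewrite TL_fun_tildeE //; last exact: unitI_five_sixths.
apply/cvg_lim => //; rewrite [in X in _ --> X]invfM [in X in _ --> X]mulrA.
rewrite -(cvg_shiftS (TL_partial H theta_tilde ^~ (5 / 6))).
rewrite (_ : (fun n => TL_partial H theta_tilde n.+1 (5 / 6)) =
    fun n => 1 / 2 - 1 / 3 * \sum_(0 <= m < n.+1) r ^+ m).
  apply: cvgB; first exact: cvg_cst; apply: cvgM; first exact: cvg_cst.
  by rewrite (cvg_shiftS (fun n => \sum_(0 <= m < n) r ^+ m)); exact: cvg_G.
apply/funext => n; rewrite TL_partialE; last exact: unitI_five_sixths.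
rewrite !(@big_ltn _ _ _ 0) // !big_add1 /= trunc_unitI; last first.
  exact: unitI_five_sixths.
have -> : dist_nat (2 ^+ 0 * (5 / 6)) = 1 / 6 :> R.
  by rewrite expr0 (dist_natE 0) ?e00_itv ?(min_idPr _); lra.
under eq_bigr do rewrite theta_tilde_five_sixths dist_nat_five_sixths.
by rewrite -mulr_suml /theta_tilde /= expr0; lra.
Qed.

End Extremisers.

(** * Attained maxima and the conclusion *)

Lemma is_max_max_attained {R : realType} {S T : Type} (A : set S) (B : set T)
    (f : S -> T -> R) (v : R) (a : S) :
  (forall a, A a -> exists m, is_max B (f a) m) -> A a -> is_max B (f a) v ->
  (forall a b, A a -> B b -> f a b <= v) -> is_max_max A B f v.
Proof.
move=> ex Aa av le.
have /choice[M MP] : forall a, exists m, A a -> is_max B (f a) m.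
  (* Outside [A] the value of [M] is arbitrary; 0 is taken. *)
  move=> a'; have [Aa'|nA] := pselect (A a'); last by exists 0.
  by have [m am] := ex a' Aa'; exists m.
exists M; split => //; split.
- exists a => //; have [[b1 B1 <-] leM] := MP a Aa.
  have [[b2 B2 <-] lev] := av.
  by apply/eqP; rewrite eq_le lev //= leM.
- by move=> a' Aa'; have [[b Bb <-] _] := MP a' Aa'; exact: le.
Qed.

Lemma is_max_unitI {R : realType} (x : R -> R) :
  {within unitI, continuous x} -> exists m, is_max unitI x m.
Proof.
move=> /(EVT_max ler01)[c c01 cmax]; exists (x c); split; first by exists c.
by move=> t t01; exact: cmax.
Qed.

(** The largest oscillation is the maximum of [x] minus its minimum. *)
Lemma is_max_unitI_osc {R : realType} (x : R -> R) :
  {within unitI, continuous x} ->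
  exists m, is_max (unitI `*` unitI) (fun p => `|x p.2 - x p.1|) m.
Proof.
move=> xc; have [c c01 cmax] := EVT_max ler01 xc.
have [d d01 dmin] := EVT_min ler01 xc.
exists `|x c - x d|; split; first by exists (d, c).
move=> [s t] [/= s01 t01].
have := (cmax s s01, cmax t t01, dmin s s01, dmin t t01) => -[[[? ?] ?] ?].
by rewrite [leRHS]ger0_norm ?ler_norml ?subr_ge0; [apply/andP; split; lra | exact: dmin].
Qed.

Theorem corollary2p6 (R : realType) (H : R) (H_gt0 : 0 < H) (H_lt1 : H < 1) :
  (let v := 1 / (3 * (1 - 2 `^ (- H))) in
   [/\ is_max_max (TL_class H) unitI (fun x t => x t) v,
       TL_class H (TL_fun H) &
       is_max unitI (TL_fun H) v])
  /\
  (let w := (2 `^ H + 3) / (6 * (2 `^ H - 1)) in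
   [/\ is_max_max (TL_class H) (unitI `*` unitI)
         (fun x p => `|x p.2 - x p.1|) w,
       TL_class H (TL_fun_tilde H) &
       `|TL_fun_tilde H (5 / 6) - TL_fun_tilde H (1 / 3)| = w]).
Proof.
have cF : TL_class H (TL_fun H).
  apply: (TL_class_lim H (fun _ _ => 1)) => // [m k|t _]; first by right.
  exact: TL_funE.
have cT : TL_class H (TL_fun_tilde H).
  apply: (TL_class_lim H theta_tilde) => // [|t t01].
    exact: theta_tilde_signs.
  exact: TL_fun_tildeE.
split=> /=.
- have mF : is_max unitI (TL_fun H) (1 / (3 * (1 - 2 `^ (- H)))).
    split; last by move=> t; exact: TL_class_le.
    by exists (1 / 3); [exact: unitI_third | exact: TL_fun_third].
  split=> //; apply: (is_max_max_attained _ _ _ _ (TL_fun H)) => //.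
    by move=> x [xc _]; exact: is_max_unitI.
  by move=> x t; exact: TL_class_le.
- have /andP[r2 r1] := ratio_itv H H_gt0 H_lt1.
  have wE : (2 `^ H + 3) / (6 * (2 `^ H - 1)) =
      2 / 3 * (1 - 2 `^ (- H))^-1 - 1 / 2.
    have -> : 2 `^ H = (2 `^ (- H))^-1 by rewrite powRN invrK.
    by field; lra.
  rewrite wE.
  have vT : `|TL_fun_tilde H (5 / 6) - TL_fun_tilde H (1 / 3)| =
      2 / 3 * (1 - 2 `^ (- H))^-1 - 1 / 2.
    rewrite TL_fun_tilde_third // TL_fun_tilde_five_sixths // invfM mulrA.
    (* This fixes the sign inside the absolute value: the value at 5/6 is the smaller one, because
       [1 / 2 <= 2 / 3]. *)
    have : 1 <= (1 - 2 `^ (- H))^-1 by rewrite invf_ge1; lra.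
    by move=> h; rewrite ler0_norm; lra.
  have le x (p : R * R) : TL_class H x -> (unitI `*` unitI) p ->
      `|x p.2 - x p.1| <= 2 / 3 * (1 - 2 `^ (- H))^-1 - 1 / 2.
    (* The two sides of the absolute value are the one-sided bound with the points in either
       order. *)
    move=> xc [p1 p2]; rewrite ler_norml lerNl opprB.
    by rewrite !TL_class_sub_le.
  split=> //; apply: (is_max_max_attained _ _ _ _ (TL_fun_tilde H)) => //.
    by move=> x [xc _]; exact: is_max_unitI_osc.
  split; last by move=> p; exact: le.
  by exists (1 / 3, 5 / 6); first by split; [exact: unitI_third | exact: unitI_five_sixths].
Qed.
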